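(* Let $(A,\dashv_A,\vdash_A)$ and $(A^*,\dashv_{A^*},\vdash_{A^*})$ be diassociative algebras, where $A^*$ is the dual space of $A$. Then $$(A,A^*,-R^*_{\bullet_A},L^*_{\vdash_A},R^*_{\dashv_A},L^*_{\bullet_A},-R^*_{\bullet_{A^*}},L^*_{\vdash_{A^*}},R^*_{\dashv_{A^*}},L^*_{\bullet_{A^*}})$$ is a matched pair of diassociative algebras if and only if there are operations $\dashv_d,\vdash_d$ on $A\oplus A^*$ such that $((A\oplus A^*,\dashv_d,\vdash_d,\omega_d),(A,\dashv_A,\vdash_A),(A^*,\dashv_{A^*},\vdash_{A^*}))$ is a standard Manin triple of diassociative algebras.
   Context: All vector spaces are finite-dimensional over a field $\mathbf{k}$ of characteristic $0$. A diassociative algebra is a triple $(A,\dashv_A,\vdash_A)$ consisting of a vector space $A$ and two bilinear operations such that for all $x,y,z\in A$ (subscripts omitted): $(x\dashv y)\dashv z=x\dashv(y\dashv z)=x\dashv(y\vdash z)$; $(x\vdash y)\dashv z=x\vdash(y\dashv z)$; $(x\vdash y)\vdash z=(x\dashv y)\vdash z=x\vdash(y\vdash z)$. Put $x\bullet_A y:=x\vdash_A y-x\dashv_A y$, and similarly $\bullet_{A^*}$, $\bullet_d$ for the other pairs of operations. For a bilinear operation $\diamond$, $L_\diamond(x)y=x\diamond y$ and $R_\diamond(y)x=x\diamond y$. For a linear map $\rho:A\to\mathrm{End}(V)$, $\rho^*:A\to\mathrm{End}(V^* )$ is the transpose: $\langle\rho^*(x)u^*,v\rangle=\langle u^*,\rho(x)v\rangle$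 (no sign). For operations on $A^*$, $(A^* )^*$ is identified with $A$. Matched pair: let $(A,\dashv_A,\vdash_A)$, $(B,\dashv_B,\vdash_B)$ be diassociative algebras and let $\ell_{\dashv_A},r_{\dashv_A},\ell_{\vdash_A},r_{\vdash_A}:A\to\mathrm{End}(B)$, $\ell_{\dashv_B},r_{\dashv_B},\ell_{\vdash_B},r_{\vdash_B}:B\to\mathrm{End}(A)$ be linear maps. The tuple $(A,B,\ell_{\dashv_A},r_{\dashv_A},\ell_{\vdash_A},r_{\vdash_A},\ell_{\dashv_B},r_{\dashv_B},\ell_{\vdash_B},r_{\vdash_B})$ is a matched pair of diassociative algebras if $A\oplus B$ is a diassociative algebra under the operations, for $*\in\{\dashv,\vdash\}$, $x,y\in A$, $a,b\in B$, $$(x+a)*_{A\bowtie B}(y+b)=\big(x*_A y+r_{*_B}(b)x+\ell_{*_B}(a)y\big)+\big(a*_B b+\ell_{*_A}(x)b+r_{*_A}(y)a\big).$$ A quadratic diassociative algebra $(A,\dashv_A,\vdash_A,\omega)$ is a diassociative algebra with a nondegenerate antisymmetric bilinear form $\omega$ that is invariant: $\omega(x,y\dashv_A z)=\omega(z,x\bullet_A y)$ and $\omega(x\vdash_A y,z)=\omega(x,y\bullet_A z)$ for all $x,y,z\in A$. A Manin triple of diassociative algebras is a collection $((A\oplus B,\dashv_d,\vdash_d,\omega),(A,\dashv_A,\vdash_A),(B,\dashv_B,\vdash_B))$ where $(A\oplus B,\dashv_d,\vdash_d,\omega)$ is a quadratic diassociative algebra, $(A,\dashv_A,\vdash_A)$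 and $(B,\dashv_B,\vdash_B)$ are diassociative subalgebras of it, and $A,B$ are isotropic with respect to $\omega$ ($\omega(A,A)=0=\omega(B,B)$). It is standard if $B=A^*$ and $\omega=\omega_d$, where $\omega_d(x+a^*,y+b^* )=\langle a^*,y\rangle-\langle x,b^*\rangle$ for $x,y\in A$, $a^*,b^*\in A^*$. *)

(* Defs.v *)
From HB Require Import structures.
From mathcomp Require Import all_boot all_order all_algebra.

Set Implicit Arguments.
Unset Strict Implicit.
Unset Printing Implicit Defensive.

Import GRing.Theory.
Local Open Scope ring_scope.

Section Diassociative.
Variables (K : fieldType) (V : vectType K).
Variables (dashv vdash : V -> V -> V).
Local Notation "x ⊣ y" := (dashv x y) (at level 40).
Local Notation "x ⊢ y" := (vdash x y) (at level 40).

Record diassociative : Prop := Diassociative {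
  dashv_bilinear : bilinear_for *:%R *:%R dashv;
  vdash_bilinear : bilinear_for *:%R *:%R vdash;
  dashv_assoc x y z : (x ⊣ y) ⊣ z = x ⊣ (y ⊣ z);
  dashv_vdash x y z : x ⊣ (y ⊣ z) = x ⊣ (y ⊢ z);
  vdash_dashv x y z : (x ⊢ y) ⊣ z = x ⊢ (y ⊣ z);
  vdash_dashvl x y z : (x ⊢ y) ⊢ z = (x ⊣ y) ⊢ z;
  vdash_assoc x y z : (x ⊣ y) ⊢ z = x ⊢ (y ⊢ z)
}.

Definition bullet (x y : V) : V := x ⊢ y - x ⊣ y.

Record quadratic (omega : V -> V -> K) : Prop := Quadratic {
  quadratic_diassociative : diassociative;
  quadratic_bilinear : bilinear_for *%R *%R omega;
  quadratic_antisym x y : omega x y = - omega y x;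
  quadratic_nondegenerate x : (forall y, omega x y = 0) -> x = 0;
  quadratic_invl x y z : omega x (y ⊣ z) = omega z (bullet x y);
  quadratic_invr x y z : omega (x ⊢ y) z = omega x (bullet y z)
}.

End Diassociative.

Section Multiplications.
Variables (K : fieldType) (V : vectType K) (op : V -> V -> V).

Definition Lmul (x : V) : 'End(V) := linfun (op x).
Definition Rmul (y : V) : 'End(V) := linfun (op^~ y).

(* [linfun] is only meaningful on linear maps, which bilinearity supplies *)
Hypothesis op_bilinear : bilinear_for *:%R *:%R op.

Lemma LmulE x y : Lmul x y = op x y.
Proof.
pose f := GRing.isLinear.Build K V V *:%R (op x) (op_bilinear.2 x).
pose g : {linear V -> V} := HB.pack (op x) f.
exact: (lfunE g).
Qed.

Lemma RmulE x y : Rmul y x = op x y.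
Proof.
pose f := GRing.isLinear.Build K V V *:%R (op^~ y) (op_bilinear.1 y).
pose g : {linear V -> V} := HB.pack (op^~ y) f.
exact: (lfunE g).
Qed.

End Multiplications.

Section Transpose.
Variables (K : fieldType) (V : vectType K).
Local Notation dual W := 'Hom(W, K^o).

Definition transpose (f : 'End(V)) : 'End(dual V) :=
  linfun (fun u : dual V => (u \o f)%VF).

Lemma transposeE (f : 'End(V)) (u : dual V) (v : V) :
  transpose f u v = u (f v).
Proof.
have lin : linear (fun u : dual V => (u \o f)%VF).
  by move=> a u1 u2; rewrite comp_lfunDl comp_lfunZl.
pose g : {linear dual V -> dual V} :=
  HB.pack (fun u : dual V => (u \o f)%VF)
    (GRing.isLinear.Build K (dual V) (dual V) *:%R _ lin).
by rewrite /transpose (lfunE g) comp_lfunE.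
Qed.

(* x |-> <-, x>, the identification of V with its bidual *)
Definition bidual : 'Hom(V, dual (dual V)) :=
  linfun (fun x : V => linfun (fun u : dual V => u x)).

Lemma bidualE (x : V) (u : dual V) : bidual x u = u x.
Proof.
have ev_lin (y : V) : linear (fun w : dual V => w y).
  by move=> a w1 w2; rewrite add_lfunE scale_lfunE.
pose ev y : {linear dual V -> K^o} :=
  HB.pack (fun w : dual V => w y)
    (GRing.isLinear.Build K (dual V) K^o *:%R _ (ev_lin y)).
have lin : linear (fun x : V => linfun (ev x)).
  move=> a y z; apply/lfunP=> w.
  by rewrite add_lfunE scale_lfunE !lfunE /= linearP.
pose g : {linear V -> dual (dual V)} :=
  HB.pack (fun x : V => linfun (ev x))
    (GRing.isLinear.Build K V (dual (dual V)) *:%R _ lin).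
by rewrite /bidual (lfunE g) lfunE.
Qed.

Lemma bidual_inj : lker bidual == 0%VS.
Proof.
apply/lker0P=> x y eqxy; apply/eqP; rewrite -subr_eq0; apply/eqP.
rewrite (coord_vbasis (memvf (x - y))) big1 // => i _.
have c_lin : linear (coord (vbasis fullv) i : V -> K^o).
  by move=> a z t; rewrite linearP.
pose c : {linear V -> K^o} :=
  HB.pack (coord (vbasis fullv) i : V -> K^o)
    (GRing.isLinear.Build K V K^o *:%R _ c_lin).
have := bidualE x (linfun c); rewrite eqxy bidualE !lfunE /= => e.
by rewrite linearB /= e subrr scale0r.
Qed.

Lemma bidual_surj : limg bidual = fullv.
Proof.
apply/eqP; rewrite eqEdim subvf /= limg_dim_eq ?(eqP bidual_inj) ?capv0 //.
have dimD (W : vectType K) : dim 'Hom(W, K^o) = dim W by exact: muln1.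
by rewrite !dimvf !dimD.
Qed.

End Transpose.

Section CoTranspose.
Variables (K : fieldType) (V : vectType K).
Local Notation dual W := 'Hom(W, K^o).

(* the transpose of f, as a map on V through the identification [bidual] *)
Definition cotranspose (f : 'End(dual V)) : 'End(V) :=
  ((bidual V)^-1 \o (transpose f \o bidual V))%VF.

Lemma cotransposeE (f : 'End(dual V)) (u : dual V) (v : V) :
  u (cotranspose f v) = f u v.
Proof.
rewrite -bidualE /cotranspose !comp_lfunE limg_lfunVK ?bidual_surj ?memvf //.
by rewrite transposeE bidualE.
Qed.

End CoTranspose.

Section MatchedPair.
Variables (K : fieldType) (A B : vectType K).

Definition bowtie (opA : A -> A -> A) (opB : B -> B -> B)
    (lA rA : A -> 'End(B)) (lB rB : B -> 'End(A)) (u v : A * B) : A * B :=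
  (opA u.1 v.1 + rB v.2 u.1 + lB u.2 v.1,
   opB u.2 v.2 + lA u.1 v.2 + rA v.1 u.2).

Record matched_pair (dashvA vdashA : A -> A -> A) (dashvB vdashB : B -> B -> B)
    (l_dashvA r_dashvA l_vdashA r_vdashA : A -> 'End(B))
    (l_dashvB r_dashvB l_vdashB r_vdashB : B -> 'End(A)) : Prop := MatchedPair {
  matched_diassocA : diassociative dashvA vdashA;
  matched_diassocB : diassociative dashvB vdashB;
  l_dashvA_linear : linear l_dashvA;
  r_dashvA_linear : linear r_dashvA;
  l_vdashA_linear : linear l_vdashA;
  r_vdashA_linear : linear r_vdashA;
  l_dashvB_linear : linear l_dashvB;
  r_dashvB_linear : linear r_dashvB;
  l_vdashB_linear : linear l_vdashB;
  r_vdashB_linear : linear r_vdashB;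
  matched_diassociative :
    diassociative (bowtie dashvA dashvB l_dashvA r_dashvA l_dashvB r_dashvB)
                  (bowtie vdashA vdashB l_vdashA r_vdashA l_vdashB r_vdashB)
}.

End MatchedPair.

Section ManinTriple.
Variables (K : fieldType) (A B : vectType K).

Record manin_triple (dashvd vdashd : A * B -> A * B -> A * B)
    (omega : A * B -> A * B -> K) (dashvA vdashA : A -> A -> A)
    (dashvB vdashB : B -> B -> B) : Prop := ManinTriple {
  manin_quadratic : quadratic dashvd vdashd omega;
  manin_diassocA : diassociative dashvA vdashA;
  manin_diassocB : diassociative dashvB vdashB;
  manin_dashvA x y : dashvd (x, 0) (y, 0) = (dashvA x y, 0);
  manin_vdashA x y : vdashd (x, 0) (y, 0) = (vdashA x y, 0);
  manin_dashvB a b : dashvd (0, a) (0, b) = (0, dashvB a b);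
  manin_vdashB a b : vdashd (0, a) (0, b) = (0, vdashB a b);
  manin_isotropicA x y : omega (x, 0) (y, 0) = 0;
  manin_isotropicB a b : omega (0, a) (0, b) = 0
}.

End ManinTriple.

Section StandardManinTriple.
Variables (K : fieldType) (A : vectType K).
Local Notation As := 'Hom(A, K^o).

Definition omega_d (u v : A * As) : K := u.2 v.1 - v.2 u.1.

Definition standard_manin_triple (dashvd vdashd : A * As -> A * As -> A * As) :=
  manin_triple dashvd vdashd omega_d.

End StandardManinTriple.

(* Main.v *)
(** A pair of operations with an invariant form is determined by the trilinear
    form P(u, v, w) = omega(u, v ⊣ w): invariance gives omega(u, v ⊢ w) =
    - P(w, u, v) and P(u, v, w) + P(v, w, u) + P(w, u, v) = 0.  Of three pure
    elements of A (+) A^*, two lie in the same summand, so the restrictions of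
    both operations to A and to A^* fix two of the three cyclic rotations of P,
    and the third by the cyclic relation.  Hence an invariant structure on
    A (+) A^* is determined by its restrictions.  The bowtie operations are
    invariant and have the given restrictions, whether or not they are
    diassociative, so they are the only candidates for a standard Manin
    triple. *)

Require Import Defs.
From HB Require Import structures.
From mathcomp Require Import all_boot all_order all_algebra.
From mathcomp Require Import ring.

Set Implicit Arguments.
Unset Strict Implicit.
Unset Printing Implicit Defensive.

Import GRing.Theory.
Local Open Scope ring_scope.

(** * Linearity of the multiplication operators and of the bullet operation *)

Lemma linear_map0 (K : pzRingType) (U V : lmodType K) (f : U -> V) :
  linear f -> f 0 = 0.
Proof.
move=> fl; have := fl (-1) 0 0.
by rewrite scaleN1r oppr0 addr0 scaleN1r addNr.
Qed.

Lemma opp_linear (K : pzRingType) (U V : lmodType K) (f : U -> V) :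
  linear f -> linear (fun x => - f x).
Proof. by move=> fl k x y; rewrite fl opprD scalerN. Qed.

Section MultiplicationLinearity.
Variables (K : fieldType) (V : vectType K) (op : V -> V -> V).
Hypothesis op_bilinear : bilinear_for *:%R *:%R op.

Lemma Lmul_linear : linear (Lmul op).
Proof.
move=> k x y; apply/lfunP => z.
by rewrite add_lfunE scale_lfunE !LmulE // op_bilinear.1.
Qed.

Lemma Rmul_linear : linear (Rmul op).
Proof.
move=> k x y; apply/lfunP => z.
by rewrite add_lfunE scale_lfunE !RmulE // op_bilinear.2.
Qed.

End MultiplicationLinearity.

Lemma bullet_bilinear (K : fieldType) (V : vectType K)
    (dashv vdash : V -> V -> V) :
  bilinear_for *:%R *:%R dashv -> bilinear_for *:%R *:%R vdash ->
  bilinear_for *:%R *:%R (bullet dashv vdash).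
Proof.
move=> [dl dr] [vl vr]; split=> u k x y; rewrite /bullet /=.
  by rewrite dl vl opprD addrACA scalerBr.
by rewrite dr vr opprD addrACA scalerBr.
Qed.

(** * Functionals, transposes and the canonical form [omega_d] *)

Section DualOperators.
Variables (K : fieldType) (V : vectType K).
Local Notation dual W := 'Hom(W, K^o).

Lemma transpose_linear (U : lmodType K) (f : U -> 'End(V)) :
  linear f -> linear (fun x => transpose (f x)).
Proof.
move=> fl k x y; apply/lfunP => u; apply/lfunP => v.
by rewrite fl !(add_lfunE, scale_lfunE, transposeE) linearP.
Qed.

Lemma functionalD (u : dual V) (x y : V) : u (x + y) = u x + u y :> K.
Proof. by rewrite linearD. Qed.

Lemma functionalN (u : dual V) (x : V) : u (- x) = - u x :> K.
Proof. by rewrite linearN. Qed.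

Lemma functionalB (u : dual V) (x y : V) : u (x - y) = u x - u y :> K.
Proof. by rewrite linearB. Qed.

(** This is the injectivity of [bidual]. It turns equations between vectors into scalar ones, the
    form in which [cotransposeE] describes a cotranspose. *)
Lemma dual_separates (x y : V) : (forall u : dual V, u x = u y) -> x = y.
Proof.
move=> eq_xy; apply: (lker0P (bidual_inj V)); apply/lfunP => u.
by rewrite !bidualE.
Qed.

Lemma cotranspose_linear (U : lmodType K) (f : U -> 'End(dual V)) :
  linear f -> linear (fun x => cotranspose (f x)).
Proof.
move=> fl k x y; apply/lfunP => v; apply: dual_separates => u.
rewrite fl cotransposeE !(add_lfunE, scale_lfunE) linearP /=.
by rewrite !cotransposeE.
Qed.

Lemma omega_d_bilinear : bilinear_for *%R *%R (@omega_d K V).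
Proof.
split=> [v k u u'|u k v v']; rewrite /omega_d /=;
  rewrite add_lfunE scale_lfunE linearP /=.
  (* Scaling in [K^o] unfolds to the product of [K], which leaves a ring identity. *)
  by rewrite /GRing.scale /=; ring.
by rewrite /GRing.scale /=; ring.
Qed.

Lemma omega_d_antisym (u v : V * dual V) : omega_d u v = - omega_d v u.
Proof. by rewrite /omega_d opprB. Qed.

(** Pairing [(x, a)] with [(0, b)] isolates [b x] up to sign, and these values determine [x];
    pairing with [(y, 0)] isolates [a y]. *)
Lemma omega_d_nondegenerate (u : V * dual V) :
  (forall v, omega_d u v = 0) -> u = 0.
Proof.
case: u => x a u0; congr pair.
  apply: dual_separates => b; have := u0 (0, b).
  by rewrite /omega_d /= !linear0 sub0r => /eqP; rewrite oppr_eq0 => /eqP.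
apply/lfunP => y; have := u0 (y, 0).
by rewrite /omega_d /= !zero_lfunE subr0.
Qed.

End DualOperators.

(** * Transport of diassociativity, and general properties of [bowtie] *)

Lemma eq_diassociative (K : fieldType) (V : vectType K)
    (dashv vdash dashv' vdash' : V -> V -> V) :
  dashv =2 dashv' -> vdash =2 vdash' ->
  diassociative dashv vdash -> diassociative dashv' vdash'.
Proof.
move=> eqd eqv [[dl dr] [vl vr] h1 h2 h3 h4 h5].
split=> [||x y z|x y z|x y z|x y z|x y z]; rewrite -?eqd -?eqv //.
- by split=> u k x y /=; rewrite -!eqd ?dl ?dr.
- by split=> u k x y /=; rewrite -!eqv ?vl ?vr.
Qed.

(** Each component of a [bowtie] product is a sum of three terms; this regroups them once each has
    been expanded by linearity. *)
Lemma scale_add3 (K : pzRingType) (V : lmodType K) (k : K) (p q r p' q' r' : V) :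
  k *: p + p' + (k *: q + q') + (k *: r + r') =
  k *: (p + q + r) + (p' + q' + r').
Proof. by rewrite !scalerDr [in LHS](addrACA (k *: p)) [LHS]addrACA. Qed.

Lemma bowtie_bilinear (K : fieldType) (A B : vectType K)
    (opA : A -> A -> A) (opB : B -> B -> B)
    (lA rA : A -> 'End(B)) (lB rB : B -> 'End(A)) :
  bilinear_for *:%R *:%R opA -> bilinear_for *:%R *:%R opB ->
  linear lA -> linear rA -> linear lB -> linear rB ->
  bilinear_for *:%R *:%R (bowtie opA opB lA rA lB rB).
Proof.
move=> [Al Ar] [Bl Br] lAl rAl lBl rBl.
split=> [[y b] k [x a] [x' a']|[x a] k [y b] [y' b']]; congr pair => /=.
- by rewrite Al lBl linearP add_lfunE scale_lfunE; apply: scale_add3.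
- by rewrite Bl lAl linearP add_lfunE scale_lfunE; apply: scale_add3.
- by rewrite Ar rBl linearP add_lfunE scale_lfunE; apply: scale_add3.
- by rewrite Br rAl linearP add_lfunE scale_lfunE; apply: scale_add3.
Qed.

Section BowtieSub.
Variables (K : fieldType) (A B : vectType K).
Variables (opA : A -> A -> A) (opB : B -> B -> B).
Variables (lA rA : A -> 'End(B)) (lB rB : B -> 'End(A)).
Hypotheses (opA_bilinear : bilinear_for *:%R *:%R opA)
  (opB_bilinear : bilinear_for *:%R *:%R opB).
Hypotheses (lA_linear : linear lA) (rA_linear : linear rA)
  (lB_linear : linear lB) (rB_linear : linear rB).

Lemma bowtie_subl x y :
  bowtie opA opB lA rA lB rB (x, 0) (y, 0) = (opA x y, 0).
Proof.
rewrite /bowtie /= (linear_map0 lB_linear) (linear_map0 rB_linear).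
by rewrite (linear_map0 (opB_bilinear.2 0)) !linear0 !zero_lfunE !addr0.
Qed.

Lemma bowtie_subr a b :
  bowtie opA opB lA rA lB rB (0, a) (0, b) = (0, opB a b).
Proof.
rewrite /bowtie /= (linear_map0 lA_linear) (linear_map0 rA_linear).
by rewrite (linear_map0 (opA_bilinear.2 0)) !linear0 !zero_lfunE !addr0.
Qed.

End BowtieSub.

(** * Additivity of bilinear maps and forms *)

Lemma bilinearDl (K : fieldType) (U V W : lmodType K) (op : U -> V -> W) :
  bilinear_for *:%R *:%R op -> forall u v w, op (u + v) w = op u w + op v w.
Proof. by move=> [opl _] u v w; have := opl w 1 u v; rewrite /= !scale1r. Qed.

Lemma bilinearDr (K : fieldType) (U V W : lmodType K) (op : U -> V -> W) :
  bilinear_for *:%R *:%R op -> forall u v w, op w (u + v) = op w u + op w v.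
Proof. by move=> [_ opr] u v w; have := opr w 1 u v; rewrite /= !scale1r. Qed.

(** A form is a bilinear map into the regular module [K^o], whose scaling is convertible to
    multiplication. *)
Lemma bilinear_formDl (K : fieldType) (V : lmodType K) (form : V -> V -> K) :
  bilinear_for *%R *%R form ->
  forall u v w, form (u + v) w = form u w + form v w.
Proof. exact: (@bilinearDl K V V K^o form). Qed.

Lemma bilinear_formDr (K : fieldType) (V : lmodType K) (form : V -> V -> K) :
  bilinear_for *%R *%R form ->
  forall u v w, form w (u + v) = form w u + form w v.
Proof. exact: (@bilinearDr K V V K^o form). Qed.

Lemma bilinear_formBr (K : fieldType) (V : lmodType K) (form : V -> V -> K) :
  bilinear_for *%R *%R form ->
  forall u v w, form u (v - w) = form u v - form u w.
Proof.
move=> bil u v w; apply/esym/eqP.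
by rewrite subr_eq -bilinear_formDr // subrK.
Qed.

(** * Uniqueness of an invariant structure with given restrictions *)

Section InvariantUniqueness.
Variables (K : fieldType) (A B : vectType K) (omega : A * B -> A * B -> K).
Hypothesis omega_bilinear : bilinear_for *%R *%R omega.
Hypothesis omega_antisym : forall u v, omega u v = - omega v u.
Hypothesis omega_nondegenerate : forall u, (forall v, omega u v = 0) -> u = 0.

(** The invariance fields of [quadratic], separated from diassociativity so that they can be
    asserted of the bowtie operations. *)
Definition invariant (dashv vdash : A * B -> A * B -> A * B) : Prop :=
  (forall u v w, omega u (dashv v w) = omega w (bullet dashv vdash u v)) /\
  (forall u v w, omega (vdash u v) w = omega u (bullet dashv vdash v w)).

Lemma omega_separates u v : (forall w, omega w u = omega w v) -> u = v.
Proof.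
move=> eq_uv; apply/eqP; rewrite -subr_eq0; apply/eqP.
apply: omega_nondegenerate => w.
(* Nondegeneracy concerns the first argument; antisymmetry moves the difference to the second, where
   the hypothesis applies. *)
by rewrite omega_antisym (bilinear_formBr omega_bilinear) eq_uv subrr oppr0.
Qed.

(** After antisymmetry, the two invariance laws lead to the same term
    [omega v (bullet dashv vdash w u)]. *)
Lemma invariant_vdash dashv vdash : invariant dashv vdash ->
  forall u v w, omega u (vdash v w) = - omega w (dashv u v).
Proof.
move=> [invd invv] u v w.
by rewrite omega_antisym invv -invd.
Qed.

(** Expanding the bullet in the first invariance law leaves one [vdash] term, which
    [invariant_vdash] turns into a rotated [dashv] term. *)
Lemma invariant_cyclic dashv vdash : invariant dashv vdash ->
  forall u v w,
  omega u (dashv v w) + omega v (dashv w u) + omega w (dashv u v) = 0.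
Proof.
move=> inv u v w; rewrite inv.1 [bullet _ _ _ _]/(_ - _).
rewrite (bilinear_formBr omega_bilinear).
by rewrite (invariant_vdash inv) addrAC subrK addNr.
Qed.

Lemma invariant_dashv_eq dashv vdash dashv' vdash' :
  bilinear_for *:%R *:%R dashv -> bilinear_for *:%R *:%R dashv' ->
  invariant dashv vdash -> invariant dashv' vdash' ->
  (forall x y, dashv (x, 0) (y, 0) = dashv' (x, 0) (y, 0)) ->
  (forall x y, vdash (x, 0) (y, 0) = vdash' (x, 0) (y, 0)) ->
  (forall a b, dashv (0, a) (0, b) = dashv' (0, a) (0, b)) ->
  (forall a b, vdash (0, a) (0, b) = vdash' (0, a) (0, b)) ->
  dashv =2 dashv'.
Proof.
move=> bil bil' inv inv' eqdA eqvA eqdB eqvB.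
(* [agree u v w] says that the two trilinear forms take the same value at [(u, v, w)]. *)
pose agree u v w := omega u (dashv v w) = omega u (dashv' v w).
have agree_vdash u v w : vdash v w = vdash' v w -> agree w u v.
  move=> eqvw; apply: oppr_inj.
  by rewrite -(invariant_vdash inv) -(invariant_vdash inv') eqvw.
have agree_cyclic u v w : agree v w u -> agree w u v -> agree u v w.
  move=> e1 e2; apply: (addIr (omega v (dashv w u))).
  apply: (addIr (omega w (dashv u v))).
  by rewrite (invariant_cyclic inv) {}e1 {}e2 (invariant_cyclic inv').
(* Equal [dashv] products settle one rotation, equal [vdash] products a second, and the cyclic
   relation the third. *)
have agreeP v w : dashv v w = dashv' v w -> vdash v w = vdash' v w ->
    forall u, [/\ agree u v w, agree w u v & agree v w u].
  move=> eqd eqv u; have uvw : agree u v w by rewrite /agree eqd.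
  by have wuv := agree_vdash u v w eqv; split=> //; apply: agree_cyclic.
have splitE u : u = (u.1, 0) + (0, u.2) :> A * B.
  by case: u => x a; congr pair; rewrite /= ?addr0 ?add0r.
move=> v w; apply: omega_separates => u; rewrite -/(agree u v w).
have PA x y := agreeP (x, 0) (y, 0) (eqdA x y) (eqvA x y).
have PB a b := agreeP (0, a) (0, b) (eqdB a b) (eqvB a b).
have AAr p x y : agree p (x, 0) (y, 0) by case: (PA x y p).
have BBr p a b : agree p (0, a) (0, b) by case: (PB a b p).
have AAl p x y : agree (x, 0) (y, 0) p by case: (PA x y p).
have BBl p a b : agree (0, a) (0, b) p by case: (PB a b p).
(* The rotation with [p] in the middle reverses the order of the other two, hence the swapped
   arguments. *)
have AAs p x y : agree (x, 0) p (y, 0) by case: (PA y x p).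
have BBs p a b : agree (0, a) p (0, b) by case: (PB b a p).
(* Splitting all three arguments yields eight pure terms. Each has two entries in the same summand,
   so one of the six families covers it. *)
rewrite (splitE u) (splitE v) (splitE w) /agree.
rewrite !(bilinearDl bil, bilinearDr bil, bilinearDl bil', bilinearDr bil').
rewrite !(bilinear_formDl omega_bilinear, bilinear_formDr omega_bilinear).
by rewrite !(AAr, BBr, AAl, BBl, AAs, BBs).
Qed.

Lemma invariant_vdash_eq dashv vdash dashv' vdash' :
  invariant dashv vdash -> invariant dashv' vdash' ->
  dashv =2 dashv' -> vdash =2 vdash'.
Proof.
move=> inv inv' eqd u v; apply: omega_separates => w.
by rewrite (invariant_vdash inv) (invariant_vdash inv') eqd.
Qed.

End InvariantUniqueness.

(** * The bowtie operations on [A * As] built from transposed multiplications *)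

Section CoadjointDouble.
Variables (K : fieldType) (A : vectType K).
Local Notation As := 'Hom(A, K^o).
Variables (dashvA vdashA : A -> A -> A) (dashvAs vdashAs : As -> As -> As).
Hypothesis dashvA_bilinear : bilinear_for *:%R *:%R dashvA.
Hypothesis vdashA_bilinear : bilinear_for *:%R *:%R vdashA.
Hypothesis dashvAs_bilinear : bilinear_for *:%R *:%R dashvAs.
Hypothesis vdashAs_bilinear : bilinear_for *:%R *:%R vdashAs.
Local Notation bulletA := (bullet dashvA vdashA).
Local Notation bulletAs := (bullet dashvAs vdashAs).

(** The eight actions here are convertible to the functions in the theorem. The [codual] ones act on
    [A] itself, its bidual being identified with it. *)
Definition dual_l_dashv x := - transpose (Rmul bulletA x).
Definition dual_r_dashv x := transpose (Lmul vdashA x).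
Definition dual_l_vdash x := transpose (Rmul dashvA x).
Definition dual_r_vdash x := transpose (Lmul bulletA x).
Definition codual_l_dashv a := - cotranspose (Rmul bulletAs a).
Definition codual_r_dashv a := cotranspose (Lmul vdashAs a).
Definition codual_l_vdash a := cotranspose (Rmul dashvAs a).
Definition codual_r_vdash a := cotranspose (Lmul bulletAs a).

Definition double_dashv : A * As -> A * As -> A * As :=
  bowtie dashvA dashvAs
    dual_l_dashv dual_r_dashv codual_l_dashv codual_r_dashv.

Definition double_vdash : A * As -> A * As -> A * As :=
  bowtie vdashA vdashAs
    dual_l_vdash dual_r_vdash codual_l_vdash codual_r_vdash.

Let bulletA_bilinear := bullet_bilinear dashvA_bilinear vdashA_bilinear.
Let bulletAs_bilinear := bullet_bilinear dashvAs_bilinear vdashAs_bilinear.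

Lemma dual_l_dashv_linear : linear dual_l_dashv.
Proof. exact/opp_linear/transpose_linear/Rmul_linear. Qed.

Lemma dual_r_dashv_linear : linear dual_r_dashv.
Proof. exact/transpose_linear/Lmul_linear. Qed.

Lemma dual_l_vdash_linear : linear dual_l_vdash.
Proof. exact/transpose_linear/Rmul_linear. Qed.

Lemma dual_r_vdash_linear : linear dual_r_vdash.
Proof. exact/transpose_linear/Lmul_linear. Qed.

Lemma codual_l_dashv_linear : linear codual_l_dashv.
Proof. exact/opp_linear/cotranspose_linear/Rmul_linear. Qed.

Lemma codual_r_dashv_linear : linear codual_r_dashv.
Proof. exact/cotranspose_linear/Lmul_linear. Qed.

Lemma codual_l_vdash_linear : linear codual_l_vdash.
Proof. exact/cotranspose_linear/Rmul_linear. Qed.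

Lemma codual_r_vdash_linear : linear codual_r_vdash.
Proof. exact/cotranspose_linear/Lmul_linear. Qed.

Lemma double_dashv_bilinear : bilinear_for *:%R *:%R double_dashv.
Proof.
exact: (bowtie_bilinear dashvA_bilinear dashvAs_bilinear dual_l_dashv_linear
  dual_r_dashv_linear codual_l_dashv_linear codual_r_dashv_linear).
Qed.

Lemma double_dashvA x y : double_dashv (x, 0) (y, 0) = (dashvA x y, 0).
Proof.
exact: (bowtie_subl _ _ _ dashvAs_bilinear codual_l_dashv_linear codual_r_dashv_linear).
Qed.

Lemma double_vdashA x y : double_vdash (x, 0) (y, 0) = (vdashA x y, 0).
Proof.
exact: (bowtie_subl _ _ _ vdashAs_bilinear codual_l_vdash_linear codual_r_vdash_linear).
Qed.

Lemma double_dashvAs a b : double_dashv (0, a) (0, b) = (0, dashvAs a b).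
Proof.
exact: (bowtie_subr _ _ _ dashvA_bilinear dual_l_dashv_linear dual_r_dashv_linear).
Qed.

Lemma double_vdashAs a b : double_vdash (0, a) (0, b) = (0, vdashAs a b).
Proof.
exact: (bowtie_subr _ _ _ vdashA_bilinear dual_l_vdash_linear dual_r_vdash_linear).
Qed.

Lemma dual_l_dashvE x (b : As) z :
  dual_l_dashv x b z = b (dashvA z x) - b (vdashA z x).
Proof.
by rewrite opp_lfunE opp_lfunE transposeE RmulE // functionalB opprB.
Qed.

Lemma dual_r_dashvE x (b : As) z : dual_r_dashv x b z = b (vdashA x z).
Proof. by rewrite transposeE LmulE. Qed.

Lemma dual_l_vdashE x (b : As) z : dual_l_vdash x b z = b (dashvA z x).
Proof. by rewrite transposeE RmulE. Qed.

Lemma dual_r_vdashE x (b : As) z :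
  dual_r_vdash x b z = b (vdashA x z) - b (dashvA x z).
Proof. by rewrite transposeE LmulE // functionalB. Qed.

Lemma codual_l_dashvE a (c : As) x :
  c (codual_l_dashv a x) = dashvAs c a x - vdashAs c a x.
Proof.
rewrite opp_lfunE functionalN cotransposeE RmulE //.
by rewrite add_lfunE opp_lfunE opprB.
Qed.

Lemma codual_r_dashvE a (c : As) x : c (codual_r_dashv a x) = vdashAs a c x.
Proof. by rewrite cotransposeE LmulE. Qed.

Lemma codual_l_vdashE a (c : As) x : c (codual_l_vdash a x) = dashvAs c a x.
Proof. by rewrite cotransposeE RmulE. Qed.

Lemma codual_r_vdashE a (c : As) x :
  c (codual_r_vdash a x) = vdashAs a c x - dashvAs a c x.
Proof. by rewrite cotransposeE LmulE // add_lfunE opp_lfunE. Qed.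

(** Writing the pairing through values of functionals on products in [A] and in [As] reduces
    invariance to a ring identity in these scalars. *)
Lemma omega_d_double_dashv u v w :
  omega_d u (double_dashv v w) =
    u.2 (dashvA v.1 w.1) + vdashAs w.2 u.2 v.1
    + (dashvAs u.2 v.2 w.1 - vdashAs u.2 v.2 w.1)
    - (dashvAs v.2 w.2 u.1 + (w.2 (dashvA u.1 v.1) - w.2 (vdashA u.1 v.1))
       + v.2 (vdashA w.1 u.1)).
Proof.
case: u v w => [x a] [y b] [z c]; rewrite /omega_d /=.
rewrite 2!functionalD codual_r_dashvE codual_l_dashvE.
by rewrite 2!add_lfunE dual_l_dashvE dual_r_dashvE.
Qed.

Lemma omega_d_double_vdash u v w :
  omega_d u (double_vdash v w) =
    u.2 (vdashA v.1 w.1) + (vdashAs w.2 u.2 v.1 - dashvAs w.2 u.2 v.1)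
    + dashvAs u.2 v.2 w.1
    - (vdashAs v.2 w.2 u.1 + w.2 (dashvA u.1 v.1)
       + (v.2 (vdashA w.1 u.1) - v.2 (dashvA w.1 u.1))).
Proof.
case: u v w => [x a] [y b] [z c]; rewrite /omega_d /=.
rewrite 2!functionalD codual_r_vdashE codual_l_vdashE.
by rewrite 2!add_lfunE dual_l_vdashE dual_r_vdashE.
Qed.

Lemma double_invariant : invariant (@omega_d K A) double_dashv double_vdash.
Proof.
have omegaBr := bilinear_formBr (@omega_d_bilinear K A).
split=> u v w; rewrite /bullet omegaBr.
  rewrite !omega_d_double_dashv omega_d_double_vdash; ring.
(* Antisymmetry brings the product on the left into the second argument, where the expansions
   apply. *)
rewrite omega_d_antisym !omega_d_double_vdash omega_d_double_dashv; ring.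
Qed.

Lemma omega_d_isotropicl (x y : A) : omega_d (x, 0 : As) (y, 0) = 0.
Proof. by rewrite /omega_d /= !zero_lfunE; apply: subrr. Qed.

Lemma omega_d_isotropicr (a b : As) : omega_d (0, a) (0, b) = 0.
Proof. by rewrite /omega_d /= 2!linear0 subr0. Qed.

End CoadjointDouble.

(** * Equivalence of matched pairs and standard Manin triples *)

Theorem theorem3p4 (K : fieldType) (char0 : [pchar K] =i pred0)
    (A : vectType K) (dashvA vdashA : A -> A -> A)
    (dashvAs vdashAs : 'Hom(A, K^o) -> 'Hom(A, K^o) -> 'Hom(A, K^o))
    (diaA : diassociative dashvA vdashA)
    (diaAs : diassociative dashvAs vdashAs) :
  let bulletA := bullet dashvA vdashA in
  let bulletAs := bullet dashvAs vdashAs in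
  matched_pair dashvA vdashA dashvAs vdashAs
    (fun x => - transpose (Rmul bulletA x))
    (fun x => transpose (Lmul vdashA x))
    (fun x => transpose (Rmul dashvA x))
    (fun x => transpose (Lmul bulletA x))
    (fun a => - cotranspose (Rmul bulletAs a))
    (fun a => cotranspose (Lmul vdashAs a))
    (fun a => cotranspose (Rmul dashvAs a))
    (fun a => cotranspose (Lmul bulletAs a))
  <-> exists dashvd vdashd :
        A * 'Hom(A, K^o) -> A * 'Hom(A, K^o) -> A * 'Hom(A, K^o),
      standard_manin_triple dashvd vdashd dashvA vdashA dashvAs vdashAs.
Proof.
move=> bulletA bulletAs.
have [dl vl _ _ _ _ _] := diaA; have [dr vr _ _ _ _ _] := diaAs.
have inv := double_invariant dl vl dr vr.
split=> [[_ _ _ _ _ _ _ _ _ _ dia]|[dashvd [vdashd]]].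
  (* The witnesses are the bowtie operations: the matched pair makes them diassociative, and [inv]
     makes [omega_d] invariant. *)
  exists (double_dashv dashvA vdashA dashvAs vdashAs).
  exists (double_vdash dashvA vdashA dashvAs vdashAs).
  split=> //.
  - split; [exact: dia|exact: omega_d_bilinear|exact: omega_d_antisym| | |].
    + exact: omega_d_nondegenerate.
    + exact: inv.1.
    + exact: inv.2.
  - exact: double_dashvA.
  - exact: double_vdashA.
  - exact: double_dashvAs.
  - exact: double_vdashAs.
  - exact: omega_d_isotropicl.
  - exact: omega_d_isotropicr.
move=> [[diad _ _ _ invd invv] _ _ dA vA dAs vAs _ _].
have [dd _ _ _ _ _ _] := diad.
(* Conversely, the Manin triple and the bowtie operations are both invariant and restrict to the
   given operations on [A] and its dual, so uniqueness applies. *)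
have eqd : dashvd =2 double_dashv dashvA vdashA dashvAs vdashAs.
  apply: (invariant_dashv_eq (@omega_d_bilinear K A) (@omega_d_antisym K A)
    (@omega_d_nondegenerate K A) dd (double_dashv_bilinear dl vl dr vr)
    (conj invd invv) inv) => *.
  - by rewrite dA double_dashvA.
  - by rewrite vA double_vdashA.
  - by rewrite dAs double_dashvAs.
  - by rewrite vAs double_vdashAs.
have eqv : vdashd =2 double_vdash dashvA vdashA dashvAs vdashAs.
  exact: (invariant_vdash_eq (@omega_d_bilinear K A) (@omega_d_antisym K A)
    (@omega_d_nondegenerate K A) (conj invd invv) inv eqd).
split; first [exact: diaA | exact: diaAs | exact: dual_l_dashv_linear
  | exact: dual_r_dashv_linear | exact: dual_l_vdash_linear
  | exact: dual_r_vdash_linear | exact: codual_l_dashv_linear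
  | exact: codual_r_dashv_linear | exact: codual_l_vdash_linear
  | exact: codual_r_vdash_linear | idtac].
(* The remaining field is diassociativity of the bowtie operations, carried over from the Manin
   triple along the pointwise equalities. *)
exact: eq_diassociative eqd eqv diad.
Qed.
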